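(* Fix a slot $t$ and a base $b\in\{\mathrm G,\mathrm L\}$. Let $\widehat{\ell}_t^b=\dfrac{\rho_t^b(A_t)\,\ell_t(A_t)}{p_t(A_t)}$, let $\ell_t^b=\langle\boldsymbol\rho_t^b,\boldsymbol\ell_t\rangle=\sum_{k=1}^K\rho_t^b(k)\ell_t(k)$, and let $\mathcal S_t=\{k\in[K]:p_t(k)>0\}$. Then \[ \mathbb E[\widehat{\ell}_t^b\mid\mathcal G_t]=\ell_t^b-B_{t,\mathrm{fb}}^b,\qquad B_{t,\mathrm{fb}}^b=\sum_{k\notin\mathcal S_t}\rho_t^b(k)\,\ell_t(k)\ \ge 0 . \] In particular, $\mathbb E[\widehat{\ell}_t^b\mid\mathcal G_t]=\ell_t^b$ whenever $p_t(k)>0$ for every $k$ with $\rho_t^b(k)>0$.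
   Context: There are $K$ channels $[K]=\{1,\dots,K\}$; $\Delta_K$ is the probability simplex in $\mathbb R^K$. In slot $t$ there are two base policies $\boldsymbol\rho_t^{\mathrm G},\boldsymbol\rho_t^{\mathrm L}\in\Delta_K$ and an executed policy $\mathbf p_t\in\Delta_K$, all determined by the public information $\mathcal P_t$ available before the action is sampled. The loss vector is $\boldsymbol\ell_t=(\ell_t(k))_{k\in[K]}\in[0,1]^K$. The $\sigma$-field $\mathcal G_t\supseteq\mathcal P_t$ contains $\mathcal P_t$, the hidden attack set committed by the adversary, the channel state, and the full loss vector $\boldsymbol\ell_t$, but not the action $A_t$. The adversary is non-anticipating: the attack set and the losses are fixed before $A_t$ is privately sampled, so that conditionally on $\mathcal G_t$ the action has law $\Pr(A_t=k\mid\mathcal G_t)=p_t(k)$. *)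

(* Defs.v *)
From HB Require Import structures.
From mathcomp Require Import all_boot all_order all_algebra.
From mathcomp Require Import all_classical all_reals all_analysis.

Set Implicit Arguments.
Unset Strict Implicit.
Unset Printing Implicit Defensive.
Import Order.TTheory GRing.Theory Num.Theory.
Import numFieldNormedType.Exports.

Local Open Scope classical_set_scope.
Local Open Scope ring_scope.

(* [adapted G C f]: f is measurable from (T, G) to (U, C). Functions into a
   finite type are taken with the discrete class C = [set: set U]. *)
Definition adapted (T U : Type) (G : set (set T)) (C : set (set U))
    (f : T -> U) : Prop :=
  preimage_set_system [set: T] f C `<=` G.

Definition sub_sigma_field d (T : measurableType d) (G : set (set T)) : Prop :=
  sigma_algebra [set: T] G /\ G `<=` measurable.

(* [is_cond_exp P G X Y]: X is integrable and Y is a version of E[X | G].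
   Versions are real-valued and defined up to P-null sets, so this is the
   meaning of the almost sure identity E[X | G] = Y for a G-measurable Y. *)
Definition is_cond_exp d (T : measurableType d) (R : realType)
    (P : probability T R) (G : set (set T)) (X Y : T -> R) : Prop :=
  [/\ P.-integrable [set: T] (EFin \o X),
      adapted G (@measurable _ (measurableTypeR R)) Y,
      P.-integrable [set: T] (EFin \o Y) &
      forall E : set T, G E ->
        (\int[P]_(w in E) (Y w)%:E = \int[P]_(w in E) (X w)%:E)%E].

Variant base : Set := BaseG | BaseL.

Section Slot.
Variables (R : realType) (K : nat).
Implicit Types (rho p l : 'I_K -> R).

Definition in_simplex p : Prop := (forall k, 0 <= p k) /\ \sum_(k < K) p k = 1.

(* Division by 0 is 0 here; the case p a = 0 has probability 0 when the action
   a is sampled from p. *)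
Definition loss_estimate rho p l (a : 'I_K) : R := rho a * l a / p a.

Definition base_loss rho l : R := \sum_(k < K) rho k * l k.

Definition active p : {set 'I_K} := [set k | 0 < p k]%SET.

Definition feedback_bias rho p l : R :=
  \sum_(k < K | k \notin active p) rho k * l k.

End Slot.

(* Main.v *)
(* Write the estimate as the sum over k of c_k 1_{A = k}, where
   c_k = rho(k) l(k) / p(k) is nonnegative and G-measurable. Pulling c_k out of
   E[1_{A = k} | G] = p(k) gives c_k p(k), which is rho(k) l(k) if p(k) > 0 and
   0 otherwise, so the sum misses exactly the bias. Although c_k is unbounded,
   it is nonnegative and c_k p(k) <= 1, so pulling it out is legitimate by
   monotone convergence along G-measurable simple functions. *)

Require Import Defs.
From HB Require Import structures.
From mathcomp Require Import all_boot all_order all_algebra.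
From mathcomp Require Import all_classical all_reals all_analysis.
From mathcomp Require Import measurable_realfun.

Set Implicit Arguments.
Unset Strict Implicit.
Unset Printing Implicit Defensive.
Import Order.TTheory GRing.Theory Num.Theory.
Import numFieldNormedType.Exports.

Local Open Scope classical_set_scope.
Local Open Scope ring_scope.

(** * Conditional expectation given a sub-sigma-field: uniqueness, pull-out, finite sums *)

Section cond_exp.
Context d (T : measurableType d) (R : realType) (P : probability T R).
Variable G : set (set T).
Hypothesis sigmaG : sub_sigma_field G.

(** [TG] is the same carrier equipped with [G], so that being adapted to [G] becomes ordinary
    measurability on [TG]. *)
Let TG := g_sigma_algebraType G.

Lemma measurable_subP (E : set T) : measurable (E : set TG) <-> G E.
Proof. by rewrite measurable_g_measurableTypeE//; exact: sigmaG.1. Qed.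

Lemma adaptedP (Y : T -> R) :
  adapted G (@measurable _ (measurableTypeR R)) Y <->
  measurable_fun [set: TG] (Y : TG -> R).
Proof.
split=> [aY _ B mB|mY _ [B mB <-]].
- by apply/measurable_subP; apply: aY; exists B.
- by apply/measurable_subP; exact: mY.
Qed.

Lemma adapted_measurable (Y : T -> R) :
  adapted G (@measurable _ (measurableTypeR R)) Y -> measurable_fun [set: T] Y.
Proof. by move=> aY _ B mB; apply: sigmaG.2; apply: aY; exists B. Qed.

(** This expresses the inclusion of [G] in the ambient sigma-field. Pushing [P] forward along this
    map restricts it to [G]. *)
Lemma measurable_id_sub : measurable_fun [set: T] (id : T -> TG).
Proof.
by move=> _ B /measurable_subP GB; rewrite setTI; exact: sigmaG.2.
Qed.

(** Both versions have the integral of [X] over each set of [G]. As they are [G]-measurable, the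
    sets where one exceeds the other lie in [G], so equality of these integrals forces equality
    almost everywhere. *)
Lemma is_cond_exp_ae_unique (X Y Z : T -> R) :
  is_cond_exp P G X Y -> is_cond_exp P G X Z -> {ae P, forall w : T, Y w = Z w}.
Proof.
move=> [_ aY iY eY] [_ aZ iZ eZ].
have mY := (adaptedP Y).1 aY.
have mZ := (adaptedP Z).1 aZ.
have mid := measurable_id_sub.
have mYE : measurable_fun [set: TG] (EFin \o (Y : TG -> R)).
  exact/measurable_EFinP.
have mZE : measurable_fun [set: TG] (EFin \o (Z : TG -> R)).
  exact/measurable_EFinP.
(* The two versions are compared under the restriction of [P] to [G]. *)
pose mu : {measure set TG -> \bar R} := pushforward P (id : T -> TG).
have [N [mN N0 YZN]] : ae_eq (mu mid) [set: TG]
    (EFin \o (Y : TG -> R)) (EFin \o (Z : TG -> R)).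
  apply: integral_ae_eq => //; first exact: integrable_pushforward.
  move=> E _ mE.
  have mE' : measurable (E : set T).
    by have := mid measurableT _ mE; rewrite setTI.
  rewrite !integral_pushforward//; last 2 first.
  - exact: integrableS iZ.
  - exact: integrableS iY.
  have GE := (measurable_subP E).1 mE.
  by rewrite [LHS](eY _ GE) [RHS](eZ _ GE).
exists N; split => //; first by have := mid measurableT _ mN; rewrite setTI.
by move=> w /= YZ; apply: YZN => /=; apply: contra_not YZ => /(_ I) [].
Qed.

Import HBNNSimple.

(** The level sets of [h] belong to [G]. For [E] in [G] the right-hand side therefore sees [X] only
    through its integrals over sets of [G], which a conditional expectation preserves. *)
Lemma integral_nnsfunM (h : {nnsfun TG >-> R}) (X : T -> R) (E : set T) :
  measurable E -> measurable_fun [set: T] X -> (forall w, 0 <= X w) ->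
  (\int[P]_(w in E) (h w * X w)%:E =
   \sum_(r \in range h)
     r%:E * \int[P]_(w in E `&` h @^-1` [set r]) (X w)%:E)%E.
Proof.
move=> mE mX X0.
have mhr r : measurable (h @^-1` [set r] : set T).
  have := measurable_id_sub measurableT (measurable_sfunP h (measurable_set1 r)).
  by rewrite setTI.
have hX w : ((h w * X w)%:E = \sum_(r \in range h)
    r%:E * (\1_(h @^-1` [set r]) w * X w)%:E)%E.
  rewrite fimfunE EFinM -fsumEFin// ge0_mule_fsuml.
    by apply: eq_fsbigr => r _; rewrite -!EFinM mulrA.
  by move=> r; exact: nnfun_muleindic_ge0.
under eq_integral do rewrite hX.
have m1X r : measurable_fun E (fun w => (\1_(h @^-1` [set r]) w * X w)%:E).
  by apply/measurable_EFinP/measurable_funTS/measurable_funM.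
rewrite ge0_integral_fsum//; last 2 first.
- by move=> r; apply: emeasurable_funM.
- move=> r w _; rewrite -EFinM mulrA EFinM mule_ge0 ?lee_fin//.
  by have := nnfun_muleindic_ge0 h r w; rewrite lee_fin.
apply: eq_fsbigr => r /set_mem [w0 _ <-].
rewrite ge0_integralZl//; last 2 first.
- by move=> w _; rewrite lee_fin mulr_ge0.
- by rewrite lee_fin.
congr (_ * _)%E; rewrite integral_mkcondr; apply: eq_integral => w _.
rewrite /patch indicE; case: ifPn => _; last by rewrite mul0r.
by rewrite mul1r.
Qed.

(** Integrability is asked of the product with [Y], not boundedness of [h]: in the application [h]
    may blow up, but only where [Y] is small. *)
Lemma is_cond_exp_pullout (h X Y : T -> R) :
  (forall w, 0 <= h w) -> (forall w, 0 <= X w) -> (forall w, 0 <= Y w) ->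
  adapted G (@measurable _ (measurableTypeR R)) h ->
  is_cond_exp P G X Y -> P.-integrable [set: T] (EFin \o (h \* Y)) ->
  is_cond_exp P G (h \* X) (h \* Y).
Proof.
move=> h0 X0 Y0 ah [iX aY iY eXY] ihY.
have mh := (adaptedP h).1 ah.
have mhE : measurable_fun [set: TG] (EFin \o (h : TG -> R)).
  exact/measurable_EFinP.
have mX : measurable_fun [set: T] X.
  exact/measurable_EFinP/(measurable_int _ iX).
have mY := adapted_measurable aY.
(* The approximation is taken on [TG], so every [g n] has its level sets in [G]. *)
pose g := nnsfun_approx measurableT mhE.
have mg n : measurable_fun [set: T] (g n : T -> R).
  by apply: adapted_measurable; apply/adaptedP; exact: measurable_funPT.
have gh w : (EFin \o g^~ w) n @[n --> \oo] --> (h w)%:E.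
  apply: (@cvg_nnsfun_approx _ TG R _ measurableT _ mhE) => // x _.
  by rewrite lee_fin.
(* Used for both [F := X] and [F := Y]; nonnegativity of [F] keeps the sequence of products
   nondecreasing. *)
have limE (F : T -> R) E : measurable_fun [set: T] F -> (forall w, 0 <= F w) ->
    measurable E ->
  (\int[P]_(w in E) (h w * F w)%:E =
     limn (fun n => \int[P]_(w in E) (g n w * F w)%:E))%E.
  move=> mF F0 mE; rewrite -monotone_convergence//.
  - apply: eq_integral => w _; apply/esym/cvg_lim => //.
    under eq_fun do rewrite EFinM.
    by rewrite EFinM; apply: cvgeZr => //; exact: gh.
  - by move=> n; apply/measurable_EFinP/measurable_funTS/measurable_funM.
  - by move=> n w _; rewrite lee_fin mulr_ge0.
  - move=> w _ m n mn; rewrite lee_fin ler_wpM2r//.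
    by have /lefP := nd_nnsfun_approx measurableT mhE mn; exact.
have eE E : G E ->
    (\int[P]_(w in E) (h w * Y w)%:E = \int[P]_(w in E) (h w * X w)%:E)%E.
  move=> GE; have mE := sigmaG.2 _ GE.
  rewrite !limE//; congr (limn _); apply/funext => n.
  rewrite !integral_nnsfunM//; apply: eq_fsbigr => r _; congr (_ * _)%E.
  apply/eXY/measurable_subP/measurableI; last exact: measurable_sfunP.
  exact/measurable_subP.
split => //.
- apply/integrableP; split.
    apply/measurable_EFinP/measurable_funM => //; exact: adapted_measurable.
  (* Both products are nonnegative, so absolute values drop and [eE] over the whole space transfers
     finiteness from [Y] to [X]. *)
  have /integrableP[_] := ihY.
  under eq_integral do rewrite /= ger0_norm ?mulr_ge0//.
  under [X in _ -> (X < _)%E]eq_integral do rewrite /= ger0_norm ?mulr_ge0//.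
  by rewrite eE//; apply/measurable_subP; exact: measurableT.
- apply/adaptedP/measurable_funM => //; exact/adaptedP.
Qed.

Lemma is_cond_exp_sum (I : Type) (s : seq I) (X Y : I -> T -> R) :
  (forall i, is_cond_exp P G (X i) (Y i)) ->
  is_cond_exp P G (fun w => \sum_(i <- s) X i w) (fun w => \sum_(i <- s) Y i w).
Proof.
move=> XY.
have sumE (F : I -> T -> R) : EFin \o (fun w => \sum_(i <- s) F i w) =
    (fun w => \sum_(i <- s) (F i w)%:E)%E.
  by apply/funext => w /=; rewrite sumEFin.
split.
- by rewrite sumE; apply: integrable_sum => // i _; have [] := XY i.
- by apply/adaptedP/measurable_sum => i; apply/adaptedP; have [] := XY i.
- by rewrite sumE; apply: integrable_sum => // i _; have [] := XY i.
- move=> E GE; have mE := sigmaG.2 _ GE.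
  have iE F : P.-integrable [set: T] F -> P.-integrable E F.
    exact: integrableS.
  under eq_integral do rewrite -sumEFin.
  under [RHS]eq_integral do rewrite -sumEFin.
  rewrite !integral_sum//; last 2 first.
  - by move=> i; apply: (iE (EFin \o X i)); have [] := XY i.
  - by move=> i; apply: (iE (EFin \o Y i)); have [] := XY i.
  by apply: eq_bigr => i _; have [_ _ _] := XY i; exact.
Qed.

End cond_exp.

(** * Pointwise algebra of the estimate and its bias *)

Section slot_estimate.
Variables (R : realType) (K : nat).
Implicit Types (rho p l : 'I_K -> R).

Lemma loss_estimate_indicE (T : Type) (A : T -> 'I_K) rho p l (w : T) :
  loss_estimate rho p l (A w) =
  \sum_(k < K) rho k * l k / p k * \1_(A @^-1` [set k]) w.
Proof.
rewrite (bigD1 (A w))//= big1 ?addr0 => [|k kA].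
  by rewrite indicE mem_set// mulr1.
by rewrite indicE memNset ?mulr0//= => Ak; rewrite Ak eqxx in kA.
Qed.

(** On active channels the division cancels. On the others nonnegativity gives [p k = 0], so the
    final factor kills the term whatever the value of the quotient. *)
Lemma base_loss_sub_biasE rho p l : (forall k, 0 <= p k) ->
  base_loss rho l - feedback_bias rho p l =
  \sum_(k < K) rho k * l k / p k * p k.
Proof.
move=> p0; rewrite /base_loss (bigID (fun k => k \notin active p))/=.
rewrite addrC addrK [RHS](bigID (fun k => k \notin active p))/=.
rewrite [X in _ = X + _]big1 ?add0r => [|k].
  apply: eq_bigr => k; rewrite negbK inE => pk.
  by rewrite divfK// gt_eqF.
by rewrite inE lt0r p0 andbT negbK => /eqP ->; rewrite mulr0.
Qed.

Lemma feedback_bias_ge0 rho p l : (forall k, 0 <= rho k) ->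
  (forall k, 0 <= l k) -> 0 <= feedback_bias rho p l.
Proof. by move=> rho0 l0; apply: sumr_ge0 => k _; rewrite mulr_ge0. Qed.

Lemma feedback_bias_eq0 rho p l : (forall k, 0 <= rho k) ->
  (forall k, 0 < rho k -> 0 < p k) -> feedback_bias rho p l = 0.
Proof.
move=> rho0 rhop; apply: big1 => k; rewrite inE => pk.
suff /eqP -> : rho k == 0 by rewrite mul0r.
by apply: contraNT pk => rhok; rewrite rhop// lt0r rhok rho0.
Qed.

End slot_estimate.

Theorem lemma1 (R : realType) (d : measure_display) (T : measurableType d)
  (P : probability T R) (K : nat)
  (dS : measure_display) (State : measurableType dS)
  (PP GG : nat -> set (set T))
  (rho : base -> nat -> T -> 'I_K -> R)
  (p loss : nat -> T -> 'I_K -> R)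
  (attack : nat -> T -> {set 'I_K})
  (state : nat -> T -> State)
  (A : nat -> T -> 'I_K)
  (t : nat) (b : base)
  (sigmaP : sub_sigma_field (PP t))
  (sigmaG : sub_sigma_field (GG t))
  (subPG : PP t `<=` GG t)
  (rho_simplex : forall (c : base) (w : T), in_simplex (rho c t w))
  (p_simplex : forall w : T, in_simplex (p t w))
  (loss01 : forall (w : T) (k : 'I_K), 0 <= loss t w k <= 1)
  (rho_adapted : forall (c : base) (k : 'I_K),
     adapted (PP t) (@measurable _ (measurableTypeR R)) (fun w => rho c t w k))
  (p_adapted : forall k : 'I_K,
     adapted (PP t) (@measurable _ (measurableTypeR R)) (fun w => p t w k))
  (loss_adapted : forall k : 'I_K,
     adapted (GG t) (@measurable _ (measurableTypeR R)) (fun w => loss t w k))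
  (attack_adapted : adapted (GG t) [set: set {set 'I_K}] (attack t))
  (state_adapted : adapted (GG t) (@measurable dS State) (state t))
  (A_measurable : adapted (@measurable d T) [set: set 'I_K] (A t))
  (A_law : forall k : 'I_K,
     is_cond_exp P (GG t) (\1_(A t @^-1` [set k])) (fun w => p t w k)) :
  let lhat := fun w => loss_estimate (rho b t w) (p t w) (loss t w) (A t w) in
  let lb := fun w => base_loss (rho b t w) (loss t w) in
  let Bfb := fun w => feedback_bias (rho b t w) (p t w) (loss t w) in
  [/\ forall w : T, 0 <= Bfb w,
      is_cond_exp P (GG t) lhat (fun w => lb w - Bfb w),
      forall Z : T -> R, is_cond_exp P (GG t) lhat Z ->
        {ae P, forall w : T, Z w = lb w - Bfb w} &
      forall Z : T -> R, is_cond_exp P (GG t) lhat Z ->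
        {ae P, forall w : T,
          (forall k : 'I_K, 0 < rho b t w k -> 0 < p t w k) -> Z w = lb w}].
Proof.
move=> lhat lb Bfb.
have rho0 w k : 0 <= rho b t w k by have [] := rho_simplex b w.
have p0 w k : 0 <= p t w k by have [] := p_simplex w.
have l0 w k : 0 <= loss t w k by have /andP[] := loss01 w k.
have mrho k := (adaptedP sigmaG _).1 (subset_trans (rho_adapted b k) subPG).
have mp k := (adaptedP sigmaG _).1 (subset_trans (p_adapted k) subPG).
have ml k := (adaptedP sigmaG _).1 (loss_adapted k).
pose c k w := rho b t w k * loss t w k / p t w k.
have c0 k w : 0 <= c k w by rewrite !mulr_ge0// invr_ge0.
have ac k : adapted (GG t) (@measurable _ (measurableTypeR R)) (c k).
  apply/(adaptedP sigmaG).
  apply: measurable_funM; first exact: measurable_funM.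
  (* [powR] handles the discontinuity of inversion at 0. *)
  under eq_fun do rewrite -powR_inv1//.
  exact: (measurableT_comp (measurable_powR _) (mp k)).
have cp1 k w : c k w * p t w k <= 1.
  rewrite /c; have [->|pk] := eqVneq (p t w k) 0; first by rewrite mulr0.
  rewrite divfK// mulr_ile1//; last by have /andP[] := loss01 w k.
  have [_ <-] := rho_simplex b w; rewrite (bigD1 k)//= lerDl.
  exact: sumr_ge0.
(* A bounded measurable function is integrable under a probability; this gives the integrability
   needed for the pull-out, although [c k] itself need not be integrable. *)
have icp k : P.-integrable [set: T] (EFin \o (c k \* (p t)^~ k)).
  apply: measurable_bounded_integrable => //.
  - by rewrite [ltLHS]probability_setT ltry.
  - apply: measurable_funM; first exact: adapted_measurable (ac k).
    exact: adapted_measurable (subset_trans (p_adapted k) subPG).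
  - exists 1; split => // M M1 w _ /=.
    rewrite ger0_norm; last by rewrite mulr_ge0.
    exact: le_trans (cp1 k w) (ltW M1).
have ce : is_cond_exp P (GG t) lhat (fun w => lb w - Bfb w).
  have -> : lhat = fun w => \sum_(k < K) (c k \* \1_(A t @^-1` [set k])) w.
    by apply/funext => w; exact: loss_estimate_indicE.
  have -> : (fun w => lb w - Bfb w) =
      fun w => \sum_(k < K) (c k \* (p t)^~ k) w.
    by apply/funext => w; exact: base_loss_sub_biasE.
  apply: (is_cond_exp_sum sigmaG) => k.
  exact: (is_cond_exp_pullout sigmaG).
have ceZ Z : is_cond_exp P (GG t) lhat Z ->
    {ae P, forall w : T, Z w = lb w - Bfb w}.
  by move=> cZ; exact: (is_cond_exp_ae_unique sigmaG cZ ce).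
split => //; first by move=> w; exact: feedback_bias_ge0.
(* The support condition is used pointwise: outside the exceptional null set, the bias vanishes at
   each [w] that satisfies it. *)
move=> Z /ceZ; apply: filterS => w -> rhop.
by rewrite /Bfb feedback_bias_eq0// subr0.
Qed.
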